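(* Let $I=[0,T]$ be a bounded time interval and let $C:I\rightrightarrows\mathbb{R}^d$ be a Lipschitz continuous set-valued map taking nonempty uniformly prox-regular values. Let $\Omega=\{(t,q): t\in I,\ q\in C(t)\}\subset\mathbb{R}\times\mathbb{R}^d$. For every $(t,q)\in\Omega$ with $t\in\mathrm{Int}(I)$, $$\mathcal{C}_{t,q}=\{u\in\mathbb{R}^d:\ (1,u)\in \mathrm{T}^D_\Omega((t,q))\}.$$
   Context: Lipschitz continuity: there is $c_0>0$ with $d_H(C(t),C(s))\le c_0|t-s|$ for all $t,s\in I$ ($d_H$ Hausdorff distance). For closed $Q\subset\mathbb{R}^d$ and $x\in Q$, $\mathrm{P}_Q(y)$ is the set of nearest points of $Q$ to $y$, $\mathrm{N}(Q,x)=\{v:\exists s>0,\ x\in \mathrm{P}_Q(x+sv)\}$; a closed set $Q$ is uniformly prox-regular if there is $\eta>0$ such that for all $x\in Q$, $v\in \mathrm{N}(Q,x)\setminus\{0\}$, the open ball $B(x+\eta v/|v|,\eta)$ does not meet $Q$. $\mathcal{C}_{t,q}=\{v=\lim_{\epsilon\searrow0}v_\epsilon\ \text{with}\ v_\epsilon\in\frac{C(t+\epsilon)-q}{\epsilon}\}$ (inner limit as $\epsilon\searrow 0$). The cone of derivable tangent vectors of a closed set $\Omega$ at $z$ is $\mathrm{T}^D_\Omega(z)=\{w=\lim_{\epsilon\searrow0}w_\epsilon\ \text{with}\ w_\epsilon\in\frac{\Omega-z}{\epsilon}\}$ (for all small $\epsilon>0$ there is such a $w_\epsilon$, converging to $w$).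 *)

(* Defs.v *)
From HB Require Import structures.
From mathcomp Require Import all_boot all_order all_algebra.
From mathcomp Require Import all_classical all_reals.
From mathcomp Require Import ereal topology normedtype.

Set Implicit Arguments.
Unset Strict Implicit.
Unset Printing Implicit Defensive.

Import Order.TTheory GRing.Theory Num.Theory.
Import numFieldNormedType.Exports.

Local Open Scope classical_set_scope.
Local Open Scope ring_scope.

(* The library norm on ['rV[R]_d] is the sup norm: it induces the usual
   topology of R^d, but nearest points, balls and distances below must be
   Euclidean. *)
Definition enorm (R : realType) (d : nat) (v : 'rV[R]_d) : R :=
  Num.sqrt (\sum_(i < d) v ord0 i ^+ 2).

Definition eball (R : realType) (d : nat) (x : 'rV[R]_d) (r : R) :
    set 'rV[R]_d :=
  [set y | enorm (y - x) < r].

(* inf_{b in B} |x - b|, equal to +oo when B is empty. *)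
Definition dist_to (R : realType) (d : nat) (B : set 'rV[R]_d)
    (x : 'rV[R]_d) : \bar R :=
  ereal_inf [set (enorm (x - b))%:E | b in B].

(* Extended-real valued, since the sets need not be bounded. *)
Definition hausdorff_dist (R : realType) (d : nat) (A B : set 'rV[R]_d) :
    \bar R :=
  Order.max (ereal_sup [set dist_to B a | a in A])
            (ereal_sup [set dist_to A b | b in B]).

Definition lipschitz_setmap (R : realType) (d : nat) (I : set R)
    (C : R -> set 'rV[R]_d) : Prop :=
  exists c0 : R, 0 < c0 /\
    forall t s : R, I t -> I s ->
      (hausdorff_dist (C t) (C s) <= (c0 * `|t - s|)%:E)%E.

Definition nearest_points (R : realType) (d : nat) (Q : set 'rV[R]_d)
    (y : 'rV[R]_d) : set 'rV[R]_d :=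
  [set x | Q x /\ forall z, Q z -> enorm (y - x) <= enorm (y - z)].

Definition proximal_normal_cone (R : realType) (d : nat) (Q : set 'rV[R]_d)
    (x : 'rV[R]_d) : set 'rV[R]_d :=
  [set v | exists s : R, 0 < s /\ nearest_points Q (x + s *: v) x].

Definition uniformly_prox_regular (R : realType) (d : nat)
    (Q : set 'rV[R]_d) : Prop :=
  closed Q /\
  exists eta : R, 0 < eta /\
    forall x v, Q x -> proximal_normal_cone Q x v -> v != 0 ->
      eball (x + (eta / enorm v) *: v) eta `&` Q = set0.

Definition diff_quotient (R : realType) (V : normedModType R) (A : set V)
    (z : V) (e : R) : set V :=
  [set e^-1 *: (x - z) | x in A].

Definition inner_limit (R : realType) (V : normedModType R)
    (S : R -> set V) : set V :=
  [set v | exists w : R -> V,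
     (\forall e \near 0^'+, S e (w e)) /\ w e @[e --> 0^'+] --> v].

Definition derivable_tangent_cone (R : realType) (V : normedModType R)
    (Omega : set V) (z : V) : set V :=
  inner_limit (diff_quotient Omega z).

Definition admissible_velocities (R : realType) (d : nat)
    (C : R -> set 'rV[R]_d) (t : R) (q : 'rV[R]_d) : set 'rV[R]_d :=
  inner_limit (fun e => diff_quotient (C (t + e)) q e).

Definition setmap_graph (R : realType) (d : nat) (I : set R)
    (C : R -> set 'rV[R]_d) : set (R * 'rV[R]_d) :=
  [set z | I z.1 /\ C z.1 z.2].

(* Main.v *)
Require Import Defs.
From HB Require Import structures.
From mathcomp Require Import all_boot all_order all_algebra.
From mathcomp Require Import all_classical all_reals.
From mathcomp Require Import ereal topology normedtype.

Import Order.TTheory GRing.Theory Num.Theory.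
Import numFieldNormedType.Exports.

Local Open Scope classical_set_scope.
Local Open Scope ring_scope.

(** The two cones differ only in the time coordinate of the approximating
points.  A family in the difference quotients of [C (t + e)] becomes one in
those of the graph by adjoining the time velocity 1, since [t + e] stays in
the interval for small [e].  Conversely, let [(t + e * a e, q + e *: b e)] be
points of the graph with [(a e, b e)] tending to [(1, u)].  The two times
[t + e * a e] and [t + e] differ by [e * (a e - 1)], so the Lipschitz estimate
gives a point [q + e *: w e] of [C (t + e)] at distance less than
[c0 * e * `|a e - 1| + e * e] from [q + e *: b e] ([hausdorff_dist_approx]).
After division by [e] the error is [c0 * `|a e - 1| + e], which tends to 0, so
[w e] has the same limit [u] as [b e] ([inner_limit_near]). *)

(** Links the Euclidean distances of the Lipschitz condition to the sup norm,
which defines the limits. *)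
Lemma mx_norm_le_enorm {R : realType} {d : nat} (v : 'rV[R]_d) :
  `|v| <= enorm v.
Proof.
rewrite [X in X <= _]mx_normrE; apply: bigmax_le => [|[i j] _ /=]; first exact: sqrtr_ge0.
rewrite (ord1 i) -sqrtr_sqr ler_wsqrtr //.
by rewrite (bigD1 j) //= lerDl sumr_ge0 // => k _; exact: sqr_ge0.
Qed.

(** The positive slack [r] is there because the infimum defining the distance
to [B] need not be attained. *)
Lemma hausdorff_dist_approx {R : realType} {d : nat} {A B : set 'rV[R]_d}
    {c r : R} {x : 'rV[R]_d} :
  (hausdorff_dist A B <= c%:E)%E -> A x -> 0 < r ->
  exists2 y, B y & `|x - y| < c + r.
Proof.
move=> AB Ax r_gt0.
have : (dist_to B x < (c + r)%:E)%E.
  apply: (@le_lt_trans _ _ c%:E); last by rewrite lte_fin ltrDl.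
  apply: le_trans AB; rewrite /hausdorff_dist le_max; apply/orP; left.
  by apply: ereal_sup_ubound; exists x.
case/ereal_inf_lt => _ [y By <-]; rewrite lte_fin => xy; exists y => //.
exact: le_lt_trans (mx_norm_le_enorm _) xy.
Qed.

Lemma diff_quotientP {R : realType} {V : normedModType R} {A : set V} {z : V}
    {e : R} {v : V} :
  0 < e -> diff_quotient A z e v <-> A (z + e *: v).
Proof.
move=> e_gt0; have e_neq0 : e != 0 by rewrite gt_eqF.
split=> [[x Ax <-]|Ax]; first by rewrite scalerA mulfV// scale1r addrC subrK.
by exists (z + e *: v) => //; rewrite addrAC subrr add0r scalerA mulVf// scale1r.
Qed.

Lemma near_right_shift {R : realType} {A : set R} {t : R} :
  interior A t -> \forall e \near 0^'+, A (t + e).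
Proof.
move=> tA; apply: cvg_within; apply: (_ : (fun e => t + e) @ 0 --> t) tA.
rewrite -[X in _ --> X]addr0; apply: cvgD; [exact: cvg_cst|exact: cvg_id].
Qed.

Lemma near_right_gt0 (R : realType) : \forall e \near (0 : R)^'+, 0 < e.
Proof. exact: nbhs_right_gt. Qed.

(** Choosing the points [w e] one [e] at a time suffices because the error
bound [r] controls all of them at once. *)
Lemma inner_limit_near (R : realType) (V : normedModType R) (S : R -> set V)
    (b : R -> V) (r : R -> R) (u : V) :
  b e @[e --> 0^'+] --> u -> r e @[e --> 0^'+] --> 0 ->
  (\forall e \near 0^'+, exists2 w, S e w & `|b e - w| <= r e) ->
  inner_limit S u.
Proof.
move=> bu r0 bS.
pose w e := xget 0 [set w | S e w /\ `|b e - w| <= r e].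
have wP : \forall e \near 0^'+, S e (w e) /\ `|b e - w e| <= r e.
  apply: filterS bS => e [v Sv bv].
  by apply: (@xgetPex _ 0 [set w | S e w /\ `|b e - w| <= r e]); exists v.
exists w; split; first by apply: filterS wP => e [].
have bw : b e - w e @[e --> 0^'+] --> 0.
  apply/norm_cvg0P; apply: squeeze_cvgr (cvg_cst 0) r0.
  by apply: filterS wP => e [_ ->]; rewrite normr_ge0.
rewrite (_ : w = fun e => b e - (b e - w e)); last first.
  by apply/funext => e; rewrite opprB addrC subrK.
by rewrite -[X in _ --> X]subr0; apply: cvgB.
Qed.

Theorem proposition2p11 (R : realType) (d : nat) (T : R)
    (C : R -> set 'rV[R]_d)
    (C_lipschitz : lipschitz_setmap `[0, T]%classic C)
    (C_nonempty : forall t : R, `[0, T]%classic t -> C t !=set0)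
    (C_prox_regular : forall t : R, `[0, T]%classic t -> uniformly_prox_regular (C t))
    (t : R) (q : 'rV[R]_d)
    (tq_Omega : setmap_graph `[0, T]%classic C (t, q))
    (t_int : interior `[0, T]%classic t) :
  admissible_velocities C t q =
  [set u : 'rV[R]_d |
    derivable_tangent_cone (setmap_graph `[0, T]%classic C) (t, q) (1, u)].
Proof.
have It : \forall e \near 0^'+, `[0, T]%classic (t + e).
  exact: near_right_shift.
apply/seteqP; split=> u /=.
- case=> w [wC wu]; exists (fun e => (1, w e)); split; last first.
    exact: (@cvg_pair _ _ _ _ (nbhs (1 : R)) (nbhs u) _ _ _ _ _ (cvg_cst _) wu).
  near=> e; have e_gt0 : 0 < e by near: e; exact: near_right_gt0.
  apply/diff_quotientP => //; split => /=.
    by rewrite [e *: _]mulr1; near: e.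
  rewrite [e *: _]mulr1; apply/diff_quotientP => //; near: e; exact: wC.
- case=> W [WO Wu]; have [c0 [c0_gt0 C_lip]] := C_lipschitz.
  have a1 : (W e).1 @[e --> 0^'+] --> (1 : R).
    exact: (cvg_comp _ _ Wu cvg_fst).
  have bu : (W e).2 @[e --> 0^'+] --> u.
    exact: (cvg_comp _ _ Wu cvg_snd).
  apply: (@inner_limit_near _ _ _ _ (fun e => c0 * `|(W e).1 - 1| + e) _ bu).
    rewrite -[X in _ --> X]addr0; apply: cvgD.
      rewrite -[X in _ --> X](mulr0 c0); apply: cvgMl_tmp.
      apply: (proj2 (norm_cvg0P _)); rewrite -[X in _ --> X](subrr 1).
      by apply: (@cvgB _ R); [exact: a1|exact: cvg_cst].
    exact: cvg_within_filter cvg_id.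
  near=> e; have e_gt0 : 0 < e by near: e; exact: near_right_gt0.
  have [] : setmap_graph `[0, T]%classic C ((t, q) + e *: W e).
    by apply/diff_quotientP => //; near: e; exact: WO.
  rewrite /= -[e *: (W e).1]/(e * (W e).1) => Is Cs.
  have Ie : `[0, T]%classic (t + e) by near: e.
  (* The slack is quadratic in [e] so that it still vanishes after division
     by [e]. *)
  have [y Cy xy] :=
    hausdorff_dist_approx (C_lip _ _ Is Ie) Cs (mulr_gt0 e_gt0 e_gt0).
  exists (e^-1 *: (y - q)); first by exists y.
  rewrite -(ler_pM2l e_gt0) -{1}(gtr0_norm e_gt0) -normrZ.
  rewrite scalerBr scalerA mulfV ?gt_eqF// scale1r opprB addrA (addrC _ q).
  apply: le_trans (ltW xy) _.
  rewrite mulrDr lerD2r mulrCA ler_wpM2l ?(ltW c0_gt0)//.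
  by rewrite opprD addrACA subrr add0r -[X in `|_ - X|]mulr1 -mulrBr normrM gtr0_norm.
Unshelve. all: by end_near.
Qed.
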